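(* Let $\alpha>-1$, $\beta>-1$, $n\ge1$ an integer. The function $\widetilde\sigma_n(\lambda)=-\left[n\lambda+\lambda\,p(n,-\lambda)-n(n+\beta)\right]$, $\lambda\in\mathbb{R}$, satisfies the Jimbo–Miwa–Okamoto $\sigma$-form of Painlevé V $$\left(\lambda\widetilde\sigma_n''\right)^2=\left[\widetilde\sigma_n-\lambda\widetilde\sigma_n'+2(\widetilde\sigma_n')^2+(2n-\alpha+\beta)\widetilde\sigma_n'\right]^2-4\widetilde\sigma_n'(\widetilde\sigma_n'-\alpha)(\widetilde\sigma_n'+n)(\widetilde\sigma_n'+n+\beta),$$ i.e. the Jimbo–Miwa $\sigma$-form with parameters $v_0=0$, $v_1=-\alpha$, $v_2=n$, $v_3=n+\beta$, with the initial conditions $$\widetilde\sigma_n(0)=n(n+\beta),\qquad\widetilde\sigma_n'(0)=-\frac{n(n+\beta)}{2n+\alpha+\beta}.$$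
   Context: For real $\lambda$, $P_n(x,\lambda)=x^n+p(n,\lambda)x^{n-1}+\cdots$ is the monic orthogonal polynomial of degree $n$ with respect to the weight $x^{\alpha}(1-x)^{\beta}e^{-\lambda x}$ on $[0,1]$; $p(n,\lambda)$ is its sub-leading coefficient. $'$ denotes $d/d\lambda$. The Jimbo–Miwa $\sigma$-form of Painlevé V with parameters $v_0,\dots,v_3$ is $(\lambda\sigma'')^2=\left[\sigma-\lambda\sigma'+2(\sigma')^2+(v_0+v_1+v_2+v_3)\sigma'\right]^2-4\prod_{i=0}^3(v_i+\sigma')$. *)

(* Defs.v *)
From HB Require Import structures.
From mathcomp Require Import all_boot all_order all_algebra.
From mathcomp Require Import all_classical all_reals all_analysis.
Import Order.TTheory GRing.Theory Num.Theory.
Import numFieldNormedType.Exports.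

Set Implicit Arguments.
Unset Strict Implicit.
Unset Printing Implicit Defensive.

Local Open Scope ring_scope.
Local Open Scope classical_set_scope.

(* [powR] gives junk values at the endpoints 0 and 1 when the exponent is
   negative; they do not affect Lebesgue integrals over [0, 1]. *)
Definition jacobi_exp_weight {R : realType} (alpha beta lambda x : R) : R :=
  x `^ alpha * (1 - x) `^ beta * expR (- lambda * x).

(* In \bar R, oo - oo = -oo, so the equation forces the integral to be finite. *)
Definition orthogonal_on01 {R : realType} (w : R -> R) (p q : {poly R}) : Prop :=
  (\int[lebesgue_measure]_(x in `[0%R, 1%R]) (p.[x] * q.[x] * w x)%:E = 0)%E.

(* [size p = k.+1] says that p has degree k. *)
Definition monic_orthogonal_polys {R : realType} (w : R -> R)
    (P : nat -> {poly R}) : Prop :=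
  (forall k : nat, P k \is monic /\ size (P k) = k.+1) /\
  (forall j k : nat, j <> k -> orthogonal_on01 w (P j) (P k)).

(* For the weights above (alpha, beta > -1) there is exactly one such sequence. The default,
   the zero sequence, is never monic. *)
Definition orthopoly {R : realType} (w : R -> R) : nat -> {poly R} :=
  xget (fun=> 0) [set P | monic_orthogonal_polys w P].

(* The coefficient of x^(n-1) in P_n(x, lambda); meaningful for n >= 1. *)
Definition subleading {R : realType} (alpha beta : R) (n : nat) (lambda : R) : R :=
  (orthopoly (jacobi_exp_weight alpha beta lambda) n)`_n.-1.

Definition sigma_tilde {R : realType} (alpha beta : R) (n : nat) (lambda : R) : R :=
  - (n%:R * lambda + lambda * subleading alpha beta n (- lambda)
     - n%:R * (n%:R + beta)).

Definition twice_derivable {R : realType} (s : R -> R) : Prop :=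
  forall t : R, derivable s t 1 /\ derivable s^`() t 1.

Definition JimboMiwa_PV {R : realType} (v0 v1 v2 v3 : R) (s : R -> R) : Prop :=
  let s' := s^`() in
  let s'' := s^`(2) in
  forall t : R,
    (t * s'' t) ^+ 2 =
      (s t - t * s' t + 2 * s' t ^+ 2 + (v0 + v1 + v2 + v3) * s' t) ^+ 2
      - 4 * ((v0 + s' t) * (v1 + s' t) * (v2 + s' t) * (v3 + s' t)).

(* Main.v *)
(** With t = - lambda the weight is x^alpha (1 - x)^beta e^(t x); let L be
    integration against it on [0, 1].  Everything follows from three facts about
    L: it is positive definite, dL(f)/dt = L(x f), and the Pearson identity
    L(x (1 - x) f' + q f) = 0 with
    q = 1 + alpha - (2 + alpha + beta) x + t x (1 - x).

    Put P = P_n, Q = P_(n-1), B = L(P^2) / L(Q^2) and let p be the subleading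
    coefficient of P.  Differentiating L(P Q) = 0 gives p' = - B, so
    sigma' = t B - n - p.  Expanding x (1 - x) P' and x (1 - x) Q' in P and Q
    with the Pearson identity yields a 2 x 2 linear system with coefficients
    polynomial in x.  At x = 0 and x = 1 the left-hand sides vanish while (P, Q)
    does not, so both determinants vanish:
      sigma' (sigma' - alpha) = - f c,
      (n + sigma') (n + beta + sigma') = - (t B + f) (c - t),
    where f and c are the constant terms of the off-diagonal entries.
    Moreover sigma'' = f + c B by the Toda equation for B.  With
    u = f (c - t) and v = c (t B + f), the bracket in the sigma-form is
    - (u + v), the product of the four factors is u v, and
    t sigma'' = v - u; hence (u + v)^2 - 4 u v = (v - u)^2 is the
    differential equation.  At t = 0 the two determinants give sigma'(0). *)

Require Import Defs.
From HB Require Import structures.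
From mathcomp Require Import all_boot all_order all_algebra.
From mathcomp Require Import all_classical all_reals all_analysis.
From mathcomp Require Import measurable_realfun ring lra.
Import Order.TTheory GRing.Theory Num.Theory.
Import numFieldNormedType.Exports.

Local Open Scope ring_scope.
Local Open Scope classical_set_scope.

Set Implicit Arguments.
Unset Strict Implicit.
Unset Printing Implicit Defensive.

(** * Derivatives integrable on the open unit interval *)

Section unit_interval_FTC.
Context {R : realType}.
Implicit Types (f F : R -> R) (x : R) (k : nat).
Local Notation leb := (@lebesgue_measure R).

(** The offset 3 keeps 1/(k+3) below 1/2, so that already for k = 0 the interval is nondegenerate
    and lies strictly inside (0, 1). *)
Definition inner_itv (k : nat) : set R := `[k.+3%:R^-1, 1 - k.+3%:R^-1].

Lemma inner_itv_lt k : (k.+3%:R^-1 : R) < 1 - k.+3%:R^-1.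
Proof.
by rewrite ltrBrDr -mulr2n -[_ *+ 2]mulr_natr ltr_pdivrMl// mulr1 ltr_nat.
Qed.

Lemma inner_itv_sub k x : inner_itv k x -> 0 < x < 1.
Proof.
rewrite /inner_itv/= in_itv/= => /andP[h1 h2].
have h0 : (0 : R) < k.+3%:R^-1 by rewrite invr_gt0 ltr0n.
apply/andP; split; [exact: lt_le_trans h1|].
by apply: (le_lt_trans h2); rewrite ltrBlDr ltrDl.
Qed.

Lemma inner_itv_nondecreasing : nondecreasing_seq inner_itv.
Proof.
move=> n m nm; apply/subsetPset => x; rewrite /inner_itv/= !in_itv/=.
have : (m.+3%:R^-1 : R) <= n.+3%:R^-1 by rewrite lef_pV2 ?posrE ?ler_nat.
by move: (n.+3%:R^-1 : R) (m.+3%:R^-1 : R) => a b h /andP[h1 h2]; apply/andP; split; lra.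
Qed.

Lemma near_inner_itv x : 0 < x < 1 -> \forall k \near \oo, inner_itv k x.
Proof.
move=> /andP[x0 x1].
have c : @harmonic R n @[n --> \oo] --> 0 := @cvg_harmonic R.
have e0 : 0 < Num.min x (1 - x) by rewrite lt_min x0 subr_gt0.
have /cvgrPdist_lt /(_ _ e0) := c.
case=> N _ hN; exists N => // n /= Nn.
have := hN n Nn; rewrite /= /harmonic sub0r normrN ger0_norm ?invr_ge0//.
rewrite lt_min => /andP[h1 h2].
have h : (n.+3%:R^-1 : R) <= n.+1%:R^-1.
  by rewrite lef_pV2 ?posrE ?ler_nat// ltnS (leq_trans (leqnSn n)).
rewrite /inner_itv/= in_itv/=; move: (n.+3%:R^-1 : R) (n.+1%:R^-1 : R) h h1 h2.
by move=> a b h h1 h2; apply/andP; split; lra.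
Qed.

Lemma bigcup_inner_itv : \bigcup_k inner_itv k = `]0, 1[.
Proof.
apply/seteqP; split => [x [k _ /inner_itv_sub]|x]; rewrite /= in_itv//=.
by move=> /near_inner_itv[N _ hN]; exists N => //; exact: (hN N (leqnn N)).
Qed.

Lemma integral_inner_itv f F k :
  (forall x, 0 < x < 1 -> {for x, continuous f}) ->
  (forall x, 0 < x < 1 -> is_derive x 1 F (f x)) ->
  (\int[leb]_(x in inner_itv k) (f x)%:E =
    (F (1 - k.+3%:R^-1) - F k.+3%:R^-1)%:E)%E.
Proof.
move=> cf dF.
have dF' x : 0 < x < 1 -> derivable F x 1 by move=> /dF h; exact: ex_derive.
have cF x : 0 < x < 1 -> {for x, continuous F}.
  by move=> /dF' /derivable1_diffP; exact: differentiable_continuous.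
have sub x : k.+3%:R^-1 <= x <= 1 - k.+3%:R^-1 -> 0 < x < 1.
  by move=> h; apply: (@inner_itv_sub k); rewrite /inner_itv/= in_itv.
rewrite (@continuous_FTC2 R f F)//.
- exact: inner_itv_lt.
- apply: continuous_in_subspaceT => x; rewrite inE/= in_itv/= => /sub; exact: cf.
- have ek := inner_itv_lt k; split.
  + move=> x; rewrite in_itv/= => /andP[/ltW h1 /ltW h2]; apply: dF'; apply: sub.
    by rewrite h1.
  + by apply: cvg_at_right_filter; apply: cF; apply: sub; rewrite lexx ltW.
  + by apply: cvg_at_left_filter; apply: cF; apply: sub; rewrite lexx ltW.
- move=> x; rewrite in_itv/= => /andP[/ltW h1 /ltW h2].
  by rewrite derive1E; apply: derive_val; apply: dF; apply: sub; rewrite h1.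
Qed.

Lemma measurable_oo01 f : (forall x, 0 < x < 1 -> {for x, continuous f}) ->
  measurable_fun `](0:R)%R, 1%R[ f.
Proof.
move=> cf; apply: open_continuous_measurable_fun.
  exact: itv_open.
by move=> x; rewrite inE/= in_itv/=; exact: cf.
Qed.

Lemma measurable_inner_itv f k :
  measurable_fun `](0:R)%R, 1%R[ f -> measurable_fun (inner_itv k) f.
Proof.
apply: measurable_funS; first exact: measurable_itv.
by rewrite -bigcup_inner_itv; exact: bigcup_sup.
Qed.

(** Monotone convergence along the inner intervals: each integral is a difference of two values of
    [F], hence at most 2 M. *)
Lemma ge0_derive_integrable01 f F (M : R) :
  (forall x, 0 < x < 1 -> {for x, continuous f}) ->
  (forall x, 0 < x < 1 -> is_derive x 1 F (f x)) ->
  (forall x, 0 < x < 1 -> 0 <= f x) ->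
  (forall x, 0 < x < 1 -> `|F x| <= M) ->
  leb.-integrable `](0:R)%R, 1%R[ (EFin \o f).
Proof.
move=> cf dF f0 FM; have mf := measurable_oo01 cf.
apply/integrableP; split; first exact/measurable_EFinP.
under eq_integral => x.
  rewrite inE/= in_itv/= => /f0 fx; rewrite ger0_norm//.
  over.
apply: (@le_lt_trans _ _ (M + M)%:E); last by rewrite ltry.
have := @ge0_nondecreasing_set_cvg_integral _ (measurableTypeR R) _ inner_itv (EFin \o f) leb
  inner_itv_nondecreasing.
rewrite bigcup_inner_itv.
have mfi i : measurable_fun (inner_itv i) (EFin \o f).
  by apply/measurable_EFinP; exact: measurable_inner_itv.
have fi0 i x : inner_itv i x -> (0 <= (EFin \o f) x)%E.
  by move=> /inner_itv_sub /f0; rewrite /= lee_fin.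
have mi i : measurable (inner_itv i : set (measurableTypeR R)) by exact: measurable_itv.
move=> /(_ mi mfi fi0)/cvg_lim <-//.
apply: lime_le.
  apply: ereal_nondecreasing_is_cvgn.
  apply: (@ge0_nondecreasing_set_nondecreasing_integral _ (measurableTypeR R)) => //.
  exact: inner_itv_nondecreasing.
apply: nearW => k; rewrite /= (integral_inner_itv _ cf dF) lee_fin.
apply: (le_trans (ler_norm _)); apply: (le_trans (ler_normB _ _)).
have ek := inner_itv_lt k; apply: lerD; apply: FM; apply: (@inner_itv_sub k);
  by rewrite /inner_itv/= in_itv/= lexx ltW.
Qed.

(** The integrand may blow up at 0 and 1. The fundamental theorem holds on each inner interval, and
    dominated convergence with majorant |f| gives the limit. *)
Lemma integral_derive01 f F (l r : R) :
  (forall x, 0 < x < 1 -> {for x, continuous f}) ->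
  (forall x, 0 < x < 1 -> is_derive x 1 F (f x)) ->
  leb.-integrable `](0:R)%R, 1%R[ (EFin \o f) ->
  F x @[x --> 0^'+] --> l -> F x @[x --> 1^'-] --> r ->
  (\int[leb]_(x in `](0:R)%R, 1%R[) (f x)%:E = (r - l)%:E)%E.
Proof.
move=> cf dF intf Fl Fr; have mf := measurable_oo01 cf.
have e_cvg : (k.+3%:R^-1 : R) @[k --> \oo] --> (0 : R).
  have := @cvg_harmonic R; rewrite -(cvg_shiftn 2%N)/=; apply: cvg_trans.
  by apply: near_eq_cvg; apply: nearW => k /=; rewrite /harmonic addn2.
have e_right : (k.+3%:R^-1 : R) @[k --> \oo] --> 0^'+.
  move=> A /= hA.
  have {}hA : \forall k \near \oo, 0 < (k.+3%:R^-1 : R) -> A k.+3%:R^-1 := e_cvg _ hA.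
  by apply: filterS hA => k; apply; rewrite invr_gt0.
have e_left : 1 - (k.+3%:R^-1 : R) @[k --> \oo] --> 1^'-.
  by move=> A /nbhs_left0P hA; exact: e_right _ hA.
pose D : set (measurableTypeR R) := `](0:R)%R, 1%R[.
pose fk k := (EFin \o f) \_ (inner_itv k).
have mD : measurable D by exact: measurable_itv.
have mE k : measurable (inner_itv k : set (measurableTypeR R)) by exact: measurable_itv.
have sub k : inner_itv k `<=` D by rewrite /D -bigcup_inner_itv; exact: bigcup_sup.
have mfk k : measurable_fun D (fk k).
  apply/(measurable_restrict _ (mE k) mD).
  rewrite setIidr//; apply/measurable_EFinP; exact: measurable_inner_itv.
have fk_f x : D x -> fk ^~ x @ \oo --> (EFin \o f) x.
  rewrite /D/= in_itv/= => /near_inner_itv near_x.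
  apply: cvg_near_cst; apply: filterS near_x => k kx.
  by rewrite /fk patchE mem_set.
have fk_le x k : D x -> (`|fk k x| <= `|(f x)%:E|)%E.
  by rewrite /fk patchE; case: ifP => // _ _; rewrite abse0.
have [_ _] := @dominated_convergence _ (measurableTypeR R) _ leb D mD
  fk (EFin \o f) (fun x => `|(f x)%:E|)%E mfk ((measurable_EFinP _ _).2 mf)
  (ltac:(apply: aeW; exact: fk_f)) (integrable_abse intf) (ltac:(apply: aeW; exact: fk_le)).
move=> /cvg_lim <-//; apply: cvg_lim => //.
have -> : [sequence \int[leb]_(x in D) fk k x]_k%E =
          fun k => (F (1 - k.+3%:R^-1) - F k.+3%:R^-1)%:E.
  apply/funext => k /=; rewrite -(integral_inner_itv _ cf dF) /fk.
  by rewrite -integral_mkcondr setIidr.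
apply: cvg_EFin; first by apply: nearW.
apply: cvgB; [exact: cvg_comp e_left Fr|exact: cvg_comp e_right Fl].
Qed.
End unit_interval_FTC.
(** * The Jacobi functional *)

Lemma finite_roots (F : idomainType) (p : {poly F}) :
  p != 0 -> finite_set [set x | root p x].
Proof.
have [n] := ubnP (size p); elim: n p => // n IH p pn p0.
have [->|/set0P[z rz]] := eqVneq [set x | root p x] set0; first exact: finite_set0.
have /factor_theorem[q qE] := rz.
have q0 : q != 0 by apply: contraNneq p0 => q0; rewrite qE q0 mul0r.
apply: (@sub_finite_set _ _ ([set z] `|` [set x | root q x])).
  move=> x /=; rewrite qE rootM root_XsubC => /orP[|/eqP] xz; [by right|by left].
rewrite finite_setU; split; first exact: finite_set1.
apply: IH => //; move: pn.
by rewrite qE size_Mmonic ?monicXsubC// size_XsubC addn2.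
Qed.

Lemma is_derive_continuous (R : realType) (f : R -> R) (x d : R) :
  is_derive x 1 f d -> {for x, continuous f}.
Proof.
by move=> h; apply/differentiable_continuous/derivable1_diffP; exact: ex_derive.
Qed.

Section weight.
Context {R : realType} (alpha beta : R).
Hypotheses (halpha : -1 < alpha) (hbeta : -1 < beta).
Local Notation leb := (@lebesgue_measure R).
Local Notation w t := (jacobi_exp_weight alpha beta (- t)).
Implicit Types (t x : R) (f g : {poly R}).

Let mI : measurable (`[(0:R)%R, 1%R] : set (measurableTypeR R)).
Proof. exact: measurable_itv. Qed.

(* Multiply by [(1 - x) + x = 1] and use [y * y `^ c = y `^ (c + 1) <= 1]. *)
Lemma beta_weight_le x : 0 < x < 1 ->
  x `^ alpha * (1 - x) `^ beta <= x `^ alpha + (1 - x) `^ beta.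
Proof.
move=> /andP[x0 x1].
have le1 (y c : R) : 0 < y < 1 -> -1 < c -> y * y `^ c <= 1.
  move=> /andP[y0 y1] c1; have := @mulr_powRB1 _ y (c + 1).
  rewrite addrK => ->; [|exact: ltW|lra].
  rewrite -[leRHS](powRr0 y); apply: ger_powR; last lra.
  by rewrite y0 ltW.
have x1' : 0 < 1 - x < 1 by apply/andP; split; lra.
have -> : x `^ alpha * (1 - x) `^ beta =
    x `^ alpha * ((1 - x) * (1 - x) `^ beta) + (x * x `^ alpha) * (1 - x) `^ beta.
  by ring.
apply: lerD.
  by rewrite -[leRHS]mulr1 ler_wpM2l ?powR_ge0// le1.
by rewrite -[leRHS]mul1r ler_wpM2r ?powR_ge0// le1// x0.
Qed.

Lemma is_derive_powR_onem (c x : R) : x < 1 ->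
  is_derive x 1 (fun y => (1 - y) `^ c) (- (c * (1 - x) `^ (c - 1))).
Proof.
move=> x1; have x1' : 0 < 1 - x by rewrite subr_gt0.
have d1 : is_derive x 1 (fun y : R => 1 - y) (-1).
  by apply: is_derive_eq; rewrite add0r mul1r.
have := @is_derive1_comp _ (@powR R ^~ c) (fun y : R => 1 - y) x _ _
  (is_derive1_powR c x1') d1.
by rewrite mulrN1.
Qed.

Lemma measurable_beta_weight :
  measurable_fun [set: R] (fun x => x `^ alpha * (1 - x) `^ beta).
Proof.
apply: measurable_funM; first exact: measurable_powR.
apply: (@measurableT_comp _ _ _ _ _ _ (@powR R ^~ beta)); first exact: measurable_powR.
exact: measurable_funB.
Qed.

Lemma integrable_beta_weight :
  leb.-integrable `[(0:R)%R, 1%R] (EFin \o (fun x => x `^ alpha * (1 - x) `^ beta)).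
Proof.
have a0 : alpha + 1 != 0 by rewrite lt0r_neq0// -ltrBlDr sub0r.
have b0 : beta + 1 != 0 by rewrite lt0r_neq0// -ltrBlDr sub0r.
have intoo : leb.-integrable `](0:R)%R, 1%R[ (EFin \o (fun x => x `^ alpha * (1 - x) `^ beta)).
  pose f x := x `^ alpha + (1 - x) `^ beta.
  (* A primitive of the majorant, bounded on (0, 1) because alpha + 1 and beta + 1 are positive. *)
  pose F x := (alpha + 1)^-1 * x `^ (alpha + 1) - (beta + 1)^-1 * (1 - x) `^ (beta + 1).
  apply: (@le_integrable _ (measurableTypeR R) R leb _ _ _ (EFin \o f)).
  - exact: measurable_itv.
  - apply/measurable_EFinP; apply: measurable_funS measurable_beta_weight => //.
  - move=> x; rewrite /= in_itv/= => x01; rewrite lee_fin !ger0_norm ?beta_weight_le//.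
      by rewrite addr_ge0 ?powR_ge0.
    by rewrite mulr_ge0 ?powR_ge0.
  apply: (@ge0_derive_integrable01 R f F ((alpha + 1)^-1 + (beta + 1)^-1)).
  - move=> x x01; have /andP[x0 x1] := x01.
    exact: is_derive_continuous
      (is_deriveD (is_derive1_powR alpha x0) (is_derive_powR_onem beta x1)).
  - move=> x x01; have /andP[x0 x1] := x01.
    have := is_deriveB (is_deriveZ (alpha + 1)^-1 (is_derive1_powR (alpha + 1) x0))
     (is_deriveZ (beta + 1)^-1 (is_derive_powR_onem (beta + 1) x1)).
    move=> h; apply: (is_derive_eq h).
    by rewrite /f !addrK /GRing.scale/= mulrN opprK !mulrA (mulVf a0) (mulVf b0) !mul1r.
  - by move=> x _; rewrite addr_ge0 ?powR_ge0.
  - move=> x x01; have /andP[x0 x1] := x01.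
    apply: (le_trans (ler_normB _ _)); rewrite !normrM.
    have le1 (y c : R) : 0 < y < 1 -> -1 < c -> `|(c + 1)^-1| * `|y `^ (c + 1)| <= (c + 1)^-1.
      move=> /andP[y0 y1] c1; rewrite !ger0_norm ?powR_ge0//; last by rewrite invr_ge0; lra.
      rewrite -[leRHS]mulr1; apply: ler_wpM2l; first by rewrite invr_ge0; lra.
      rewrite -[leRHS](powRr0 y); apply: ger_powR; last lra.
      by rewrite y0 ltW.
    by apply: lerD; apply: le1 => //; apply/andP; split; lra.
apply/integrableP; split.
  apply/measurable_EFinP; apply: measurable_funS measurable_beta_weight => //.
have /integrableP[mo lty] := intoo.
by rewrite integral_itv_bndoo//; exact: measurableT_comp.
Qed.

Lemma continuous_poly_expR t f : continuous (fun x => f.[x] * expR (- - t * x)).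
Proof.
move=> x; apply: cvgM; first exact: continuous_horner.
apply: (@continuous_comp _ _ _ (fun x => - - t * x) expR).
  by apply: cvgM; [exact: cvg_cst|exact: cvg_id].
exact: continuous_expR.
Qed.

Lemma measurable_poly_weight t f : measurable_fun [set: R] (fun x => f.[x] * w t x).
Proof.
apply: measurable_funM; first exact: continuous_measurable_fun (@continuous_horner R f).
apply: measurable_funM; first exact: measurable_beta_weight.
have := continuous_measurable_fun (@continuous_poly_expR t 1).
by apply: eq_measurable_fun => x _; rewrite hornerC mul1r.
Qed.

Lemma integrable_poly_weight t f :
  leb.-integrable `[(0:R)%R, 1%R] (EFin \o (fun x => f.[x] * w t x)).
Proof.
pose h x := f.[x] * expR (- - t * x).
have ch : continuous h := @continuous_poly_expR t f.
have mh : measurable_fun `[(0:R)%R, 1%R] h.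
  by apply: measurable_funS (continuous_measurable_fun ch).
have bh : [bounded h x | x in `[(0:R)%R, 1%R]].
  have /compact_bounded[M [Mr hM]] : compact (h @` `[(0:R)%R, 1%R]).
    apply: continuous_compact; last exact: segment_compact.
    exact: continuous_subspaceT.
  by exists M; split => // y My x xD; apply: (hM y My); exists x.
have := @integrableMl _ (measurableTypeR R) _ leb _ (measurable_itv _) _ _
  integrable_beta_weight mh bh.
apply: eq_integrable => //= x _.
by rewrite /h /jacobi_exp_weight -EFinM; congr EFin; ring.
Qed.

Definition jacobi_functional t f : R :=
  \int[leb]_(x in `[0%R, 1%R]) (f.[x] * w t x).
Local Notation L := jacobi_functional.

(** Integrability makes the extended-real integral finite, so nothing is lost in passing to the
    real-valued functional. *)
Lemma orthogonal_on01E t f g : orthogonal_on01 (w t) f g <-> L t (f * g) = 0.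
Proof.
have fin := integrable_fin_num mI (integrable_poly_weight t (f * g)).
rewrite /orthogonal_on01 /L /Rintegral.
have -> : (\int[leb]_(x in `[0%R, 1%R]) (f.[x] * g.[x] * w t x)%:E =
           \int[leb]_(x in `[0%R, 1%R]) ((f * g).[x] * w t x)%:E)%E.
  by apply: eq_integral => x _; rewrite hornerM.
by split=> [->//|h]; rewrite -[LHS]fineK// h.
Qed.

Lemma jacobi_functionalD t f g : L t (f + g) = L t f + L t g.
Proof.
rewrite /L -RintegralD//; last 2 first.
- exact: integrable_poly_weight.
- exact: integrable_poly_weight.
by apply: eq_Rintegral => x _; rewrite hornerD mulrDl.
Qed.

Lemma jacobi_functionalC t (c : R) f : L t (c%:P * f) = c * L t f.
Proof.
rewrite /L -RintegralZl//; last exact: integrable_poly_weight.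
by apply: eq_Rintegral => x _; rewrite hornerM hornerC -mulrA.
Qed.

(** A nonnegative integrand with zero integral vanishes almost everywhere. The weight is positive on
    (0, 1), so for nonzero [f] the finitely many roots and one null set would cover an interval of
    measure 1. *)
Lemma jacobi_functional_sqr_eq0 t f : L t (f * f) = 0 -> f = 0.
Proof.
move=> Lf; have /orthogonal_on01E := Lf; rewrite /orthogonal_on01 => h.
have int := integrable_poly_weight t (f * f).
have mf := measurable_int leb int.
have /(ae_eq_integral_abs leb mI mf) :
    (\int[leb]_(x in `[0%R, 1%R]) `|(EFin \o (fun x => ((f * f).[x] * w t x)%R)) x| = 0)%E.
  rewrite -[RHS]h; apply: eq_integral => x _.
  rewrite /= hornerM ger0_norm// mulr_ge0 -?expr2 ?sqr_ge0//.
  by rewrite /jacobi_exp_weight !mulr_ge0 ?powR_ge0 ?expR_ge0.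
case=> N [mN N0 sN]; apply/eqP; apply: contraT => f0.
pose Z : set (measurableTypeR R) := [set x | root f x].
have cZ : countable Z by apply: finite_set_countable; exact: finite_roots.
have mZ : measurable Z.
  by apply: countable_measurable cZ => x; exact: measurable_set1.
have Z0 : leb Z = 0 := countable_lebesgue_measure0 cZ.
have NZ0 : leb (N `|` Z) = 0.
  apply: measure_negligible; first exact: measurableU.
  apply: negligibleU; [exists N|exists Z]; split => //.
have sub : `](0:R)%R, 1%R[ `<=` N `|` Z.
  move=> x /=; rewrite in_itv/= => /andP[x0 x1].
  have [rx|rx] := boolP (root f x); [by right|left].
  apply: sN => /= hx; have := hx; rewrite /= in_itv/= (ltW x0) (ltW x1).
  move=> /(_ isT) [] /eqP; rewrite hornerM.
  have w0 : w t x != 0.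
    by rewrite /jacobi_exp_weight !mulf_neq0 ?expR_eq0 ?gt_eqF ?powR_gt0 ?subr_gt0.
  move: (w t x) w0 => W w0; rewrite !mulf_eq0 (negPf w0) orbb orbF.
  by move: rx; rewrite /root => /negPf ->.
have : (leb (`](0:R)%R, 1%R[ : set (measurableTypeR R)) <= leb (N `|` Z))%E.
  by apply: le_measure => //; rewrite inE; [exact: measurable_itv|exact: measurableU].
by rewrite NZ0 lebesgue_measure_itv/= lte01 oppr0 adde0 lee_fin ler10.
Qed.

Lemma powR_add1 (x c : R) : 0 < x -> x `^ (c + 1) = x * x `^ c.
Proof.
move=> x0; rewrite powRD; last by rewrite (gt_eqF x0) implybT.
by rewrite powRr1 1?mulrC// ltW.
Qed.

Lemma is_derive_expR_scaled t x :
  is_derive x 1 (fun y => expR (- - t * y)) (t * expR (- - t * x)).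
Proof.
have d1 : is_derive x 1 (fun y : R => - - t * y) t.
  by apply: is_derive_eq; rewrite /GRing.scale/=; ring.
have := @is_derive1_comp _ expR (fun y : R => - - t * y) x _ _ (is_derive_expR _) d1.
by rewrite mulrC.
Qed.

Lemma is_derive_horner f x : is_derive x 1 (horner f) f^`().[x].
Proof.
by apply: DeriveDef; [exact: derivable_horner|rewrite -derive1E -derivE].
Qed.

(** The integrand is the derivative of x^(alpha+1) (1-x)^(beta+1) f(x) e^(t x), which tends to 0 at
    both ends because the two exponents are positive. *)
Lemma jacobi_functional_pearson t f :
  L t ('X * (1 - 'X) * f^`() +
       (1 + alpha)%:P * f - (2 + alpha + beta)%:P * ('X * f)
       + t%:P * ('X * (1 - 'X) * f)) = 0.
Proof.
set g := (X in L t X).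
have intg := integrable_poly_weight t g.
pose U x := (x `^ (alpha + 1) * (1 - x) `^ (beta + 1)) * (f.[x] * expR (- - t * x)).
have cE x : {for x, continuous (fun x => f.[x] * expR (- - t * x))}.
  exact: continuous_poly_expR.
have a0 : 0 < alpha + 1 by rewrite -ltrBlDr sub0r.
have b0 : 0 < beta + 1 by rewrite -ltrBlDr sub0r.
suff : (\int[leb]_(x in `](0:R)%R, 1%R[) (g.[x] * w t x)%:E = (0 - 0)%:E)%E.
  rewrite subrr => h; rewrite /L /Rintegral integral_itv_bndoo ?h//.
  by apply/measurable_EFinP; apply: measurable_funS (measurable_poly_weight t g).
apply: (@integral_derive01 R (fun x => g.[x] * w t x) U).
- move=> x /andP[x0 x1]; apply: cvgM; first exact: continuous_horner.
  apply: cvgM; last exact: is_derive_continuous (is_derive_expR_scaled t x).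
  apply: cvgM; first exact: is_derive_continuous (is_derive1_powR alpha x0).
  exact: is_derive_continuous (is_derive_powR_onem beta x1).
- move=> x /andP[x0 x1].
  have := is_deriveM
    (is_deriveM (is_derive1_powR (alpha + 1) x0) (is_derive_powR_onem (beta + 1) x1))
    (is_deriveM (is_derive_horner f x) (is_derive_expR_scaled t x)).
  move=> h; apply: (is_derive_eq h).
  rewrite /GRing.scale/= !fctE /g /jacobi_exp_weight !addrK !powR_add1// ?subr_gt0//.
  rewrite !hornerE/=; ring.
- by apply: integrableS intg => //; exact: subset_itv_oo_cc.
- have : U x @[x --> 0^'+] --> 0 * (1 - 0) `^ (beta + 1) * (f.[0] * expR (- - t * 0)).
    apply: cvgM; last by apply: cvg_at_right_filter; exact: cE.
    apply: cvgM; first exact: powR_cvg0.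
    apply: cvg_at_right_filter.
    exact: (is_derive_continuous (is_derive_powR_onem (beta + 1) ltr01)).
  by rewrite !mul0r.
- have : U x @[x --> 1^'-] --> 1 `^ (alpha + 1) * 0 * (f.[1] * expR (- - t * 1)).
    apply: cvgM; last by apply: cvg_at_left_filter; exact: cE.
    apply: cvgM.
      apply: cvg_at_left_filter.
      exact: (is_derive_continuous (is_derive1_powR (alpha + 1) ltr01)).
    (* The substitution e = 1 - x turns the left limit at 1 into a right limit at 0. *)
    apply: cvg_comp (powR_cvg0 b0).
    move=> A /= hA; apply/nbhs_left0P; apply: filterS hA => e.
    by rewrite -[X in A X](subKr 1 e).
  by rewrite mulr0 mul0r.
Qed.

Lemma is_derive_jacobi_functional t f : is_derive t 1 (L ^~ f) (L t ('X * f)).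
Proof.
pose F s x := f.[x] * w s x.
(* For |s - t| < 1 and x in [0, 1], e^(s x) is at most e^(|t| + 1), so [G] dominates the derivative
   in s uniformly. *)
pose G x := `|('X * f).[x] * w 0 x| * expR (`|t| + 1).
have dF (s x : R) : is_derive s 1 (F ^~ x) (('X * f).[x] * w s x).
  have d1 : is_derive s 1 (fun s : R => - - s * x) x.
    by apply: is_derive_eq; rewrite /GRing.scale/=; ring.
  have := is_deriveZ (f.[x] * (x `^ alpha * (1 - x) `^ beta))
    (@is_derive1_comp _ expR (fun s : R => - - s * x) s _ _ (is_derive_expR _) d1).
  have -> : F ^~ x = (f.[x] * (x `^ alpha * (1 - x) `^ beta)) \*:
      (expR \o (fun s : R => - - s * x)).
    by apply/funext => r; rewrite /F /jacobi_exp_weight /GRing.scale/= !mulrA.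
  move=> h; apply: (is_derive_eq h).
  by rewrite /GRing.scale/= /jacobi_exp_weight !hornerE/=; ring.
have intF (s : R) : `]t - 1, t + 1[ s -> leb.-integrable `[(0:R)%R, 1%R] (EFin \o F s).
  by move=> _; exact: integrable_poly_weight.
have derF (s x : R) : `]t - 1, t + 1[ s -> `[(0:R)%R, 1%R] x -> derivable (F ^~ x) s 1.
  by move=> _ _; have h := dF s x; exact: ex_derive.
have G0 (x : R) : 0 <= G x by rewrite mulr_ge0 ?expR_ge0.
have It : `]t - 1, t + 1[ t.
  by rewrite /= in_itv/=; apply/andP; split; lra.
have intG : leb.-integrable `[(0:R)%R, 1%R] (EFin \o G).
  have := integrableZr mI (expR (`|t| + 1))
    (integrable_abse (integrable_poly_weight 0 ('X * f))).
  by apply: eq_integrable.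
have FG (s x : R) : `]t - 1, t + 1[ s -> `[(0:R)%R, 1%R] x -> `|partial1of2 F s x| <= G x.
  rewrite /= !in_itv/= => /andP[s1 s2] /andP[x0 x1].
  have h := dF s x; rewrite partial1of2E derive_val /G /jacobi_exp_weight !normrM.
  rewrite !(ger0_norm (expR_ge0 _)) oppr0 oppr0 mul0r expR0 mulr1 !mulrA.
  apply: ler_wpM2l; first by rewrite !mulr_ge0.
  rewrite ler_expR opprK.
  have t1 := ler_norm t; have t2 := ler_norm (- t); rewrite normrN in t2.
  apply: (@le_trans _ _ (`|s| * x)); first by rewrite ler_wpM2r// ler_norm.
  apply: (@le_trans _ _ `|s|); first by rewrite ler_piMr.
  by rewrite ler_norml; apply/andP; split; lra.
have := derivable_under_integral mI It intF derF G0 intG FG.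
have := differentiation_under_integral mI It intF derF G0 intG FG.
move=> h1 h2; apply: DeriveDef => //.
rewrite -derive1E [LHS]h1; apply: eq_Rintegral => x _.
by have h := dF t x; rewrite partial1of2E derive_val.
Qed.
End weight.
(** * Orthogonal polynomials of a definite functional *)

Section orthogonal_polynomials.
Context {F : fieldType} (L : {poly F} -> F).
Implicit Types (f g P Q G : {poly F}).

(** Definiteness stands in for positivity, so that the algebra uses no order and runs over any
    field. *)
Definition definite_functional :=
  [/\ forall f g, L (f + g) = L f + L g,
      forall (c : F) f, L (c%:P * f) = c * L f &
      forall f, L (f * f) = 0 -> f = 0].

(** Orthogonality to all lower degrees characterises each [P] on its own, without the rest of a
    sequence. *)
Definition orthogonal_poly n P :=
  [/\ P \is monic, size P = n.+1 &
      forall G, (size G <= n)%N -> L (P * G) = 0].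

Hypothesis Lok : definite_functional.
Let LD f g : L (f + g) = L f + L g. Proof. by case: Lok. Qed.
Let LC c f : L (c%:P * f) = c * L f. Proof. by case: Lok. Qed.
Let Ldef f : L (f * f) = 0 -> f = 0. Proof. by case: Lok => _ _; apply. Qed.

Lemma functional0 : L 0 = 0.
Proof. by rewrite -[0 in LHS](mul0r 0) -polyC0 LC mul0r. Qed.

Lemma functionalN f : L (- f) = - L f.
Proof. by rewrite -mulN1r -polyCN LC mulN1r. Qed.

Lemma functionalB f g : L (f - g) = L f - L g.
Proof. by rewrite LD functionalN. Qed.

Lemma functional_sum (I : Type) (r : seq I) (A : pred I) (f : I -> {poly F}) :
  L (\sum_(i <- r | A i) f i) = \sum_(i <- r | A i) L (f i).
Proof. exact: (big_morph L LD functional0). Qed.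

Lemma orthogonal_poly_coef n P : orthogonal_poly n P -> P`_n = 1.
Proof. by case=> /monicP + sP _; rewrite /lead_coef sP. Qed.

Lemma size_sub_lead n P G : P \is monic -> size P = n.+1 -> (size G <= n.+1)%N ->
  (size (G - (G`_n)%:P * P)%R <= n)%N.
Proof.
move=> /monicP; rewrite /lead_coef => + sP sG; rewrite sP/= => P1.
apply/leq_sizeP => j; rewrite leq_eqVlt => /predU1P[<-|nj].
  by rewrite coefB coefCM P1 mulr1 subrr.
by rewrite coefB coefCM (nth_default _ (leq_trans sG nj)) (@nth_default _ _ P) ?sP// mulr0 subr0.
Qed.

(** Up to a multiple of [P], [G] has lower degree, so pairing with [P] sees only the top
    coefficient. *)
Lemma orthogonal_poly_lead n P G : orthogonal_poly n P -> (size G <= n.+1)%N ->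
  L (P * G) = G`_n * L (P * P).
Proof.
move=> [mP sP oP] sG; rewrite -LC.
have -> : P * G = (G`_n)%:P * (P * P) + P * (G - (G`_n)%:P * P) by ring.
by rewrite LD oP ?addr0//; exact: size_sub_lead.
Qed.

Lemma orthogonal_poly_norm_neq0 n P : orthogonal_poly n P -> L (P * P) != 0.
Proof.
by move=> [mP _ _]; apply: contraNneq (monic_neq0 mP) => /Ldef ->.
Qed.

(** The difference has lower degree, so it is orthogonal to both polynomials and hence to itself. *)
Lemma orthogonal_poly_unique n P Q :
  orthogonal_poly n P -> orthogonal_poly n Q -> P = Q.
Proof.
move=> oP oQ; have [mP sP P0] := oP; have [mQ sQ Q0] := oQ.
have sPQ : (size (P - Q)%R <= n)%N.
  have := @size_sub_lead n Q P mQ sQ; rewrite (orthogonal_poly_coef oP) mul1r; apply.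
  by rewrite sP.
apply/eqP; rewrite -subr_eq0; apply/eqP/Ldef.
by rewrite {1}mulrBl functionalB P0// Q0// subrr.
Qed.

(** Monic polynomials of degrees 0, ..., n - 1 span all lower degrees; the induction peels off the
    top coefficient. *)
Lemma functional_mul_eq0 n P (S : nat -> {poly F}) G :
  (forall k, (k < n)%N -> S k \is monic /\ size (S k) = k.+1) ->
  (forall k, (k < n)%N -> L (P * S k) = 0) ->
  (size G <= n)%N -> L (P * G) = 0.
Proof.
elim: n G => [|n IH] G hS hP sG.
  by move: sG; rewrite leqn0 size_poly_eq0 => /eqP ->; rewrite mulr0 functional0.
have [mS sS] := hS n (ltnSn n).
have -> : P * G = (G`_n)%:P * (P * S n) + P * (G - (G`_n)%:P * S n) by ring.
rewrite LD LC hP// mulr0 add0r; apply: IH => [k kn|k kn|].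
- by apply: hS; apply: ltnW.
- by apply: hP; apply: ltnW.
- exact: size_sub_lead.
Qed.

Lemma orthogonal_poly_mul_eq0 j k P Q :
  orthogonal_poly j P -> orthogonal_poly k Q -> j <> k -> L (P * Q) = 0.
Proof.
move=> [_ sP oP] [_ sQ oQ] jk; have [jk'|kj'|//] := ltngtP j k.
  by rewrite mulrC oQ// sP.
by rewrite oP// sQ.
Qed.

(** The formula is kept explicit because its coefficients, quotients of values of [L], are later
    differentiated in the parameter. *)
Lemma orthogonal_poly_gram_schmidt n (S : nat -> {poly F}) :
  (forall k, (k < n)%N -> orthogonal_poly k (S k)) ->
  orthogonal_poly n
    ('X^n - \sum_(k < n) (L ('X^n * S k) / L (S k * S k))%:P * S k).
Proof.
move=> oS; set T := \sum_(k < n) _.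
have sT : (size T <= n)%N.
  apply: (leq_trans (size_sum _ _ _)); apply/bigmax_leqP => k _.
  rewrite mul_polyC; apply: (leq_trans (size_scale_leq _ _)).
  by have [_ -> _] := oS k (ltn_ord k).
split.
- rewrite monicE lead_coefDl ?lead_coefXn// size_polyN size_polyXn ltnS//.
- by rewrite size_polyDl ?size_polyXn// size_polyN ltnS.
- move=> G; apply: (@functional_mul_eq0 _ _ S) => k kn; have := oS k kn; first by case.
  move=> oSk; rewrite mulrBl functionalB mulr_suml functional_sum.
  rewrite (bigD1 (Ordinal kn))//= -mulrA LC divfK ?(orthogonal_poly_norm_neq0 oSk)//.
  rewrite big1 ?addr0 ?subrr// => i /eqP ik.
  rewrite -mulrA LC (orthogonal_poly_mul_eq0 (oS i (ltn_ord i)) oSk) ?mulr0//.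
  by move=> ik'; apply: ik; apply: val_inj.
Qed.
End orthogonal_polynomials.
(** * Ladder relations *)

Section ladder.
Context {F : fieldType} (L : {poly F} -> F) (alpha beta t : F).
Implicit Types (f G : {poly F}).
Hypothesis Lok : definite_functional L.
Let LD f G : L (f + G) = L f + L G. Proof. by case: Lok. Qed.
Let LC c f : L (c%:P * f) = c * L f. Proof. by case: Lok. Qed.
Let LB f G : L (f - G) = L f - L G := functionalB Lok f G.

(** This is (x (1 - x) w)' / w for w = x^alpha (1 - x)^beta e^(t x). *)
Definition pearson_poly : {poly F} :=
  (1 + alpha)%:P - (2 + alpha + beta)%:P * 'X + t%:P * ('X * (1 - 'X)).
Local Notation q := pearson_poly.
Hypothesis pearson : forall f, L ('X * (1 - 'X) * f^`() + q * f) = 0.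

Lemma coefXderiv f i : ('X * f^`())`_i = f`_i * i%:R.
Proof. by rewrite coefXM coef_deriv mulr_natr; case: i => [|i]; rewrite ?mulr0n. Qed.

(** [a] and [b] are the diagonal three-term recurrence coefficients at degrees m + 1 and m, and [B]
    is the off-diagonal one. *)
Variables (m : nat) (P Q : {poly F}) (h g a b B : F).
Hypotheses (oP : orthogonal_poly L m.+1 P) (oQ : orthogonal_poly L m Q).
Hypotheses (Lh : L (P * P) = h) (Lg : L (Q * Q) = g) (BE : B * g = h).
Hypotheses (LXPP : L ('X * (P * P)) = a * h) (LXQQ : L ('X * (Q * Q)) = b * g).

Local Notation n := (m.+1%:R : F).
Local Notation p := (P`_m).
(** [s] will be the value of sigma'; [fQ] and [cP] are the constant terms of the off-diagonal
    entries of the ladder system. *)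
Local Notation s := (t * B - n - p).
Local Notation fQ := (B * (2 * n + 1 + alpha + beta - t + t * a)).
Local Notation cP := (t - t * b - (2 * n - 1 + alpha + beta)).

Let h0 : h != 0. Proof. by rewrite -Lh; exact: orthogonal_poly_norm_neq0 oP. Qed.
Let g0 : g != 0. Proof. by rewrite -Lg; exact: orthogonal_poly_norm_neq0 oQ. Qed.
Let sP : size P = m.+2. Proof. by case: oP. Qed.
Let sQ : size Q = m.+1. Proof. by case: oQ. Qed.
Let P1 : P`_m.+1 = 1. Proof. exact: orthogonal_poly_coef oP. Qed.
Let Q1 : Q`_m = 1. Proof. exact: orthogonal_poly_coef oQ. Qed.
Let LP G : (size G <= m.+1)%N -> L (P * G) = 0. Proof. by case: oP => _ _; apply. Qed.
Let LQ G : (size G <= m)%N -> L (Q * G) = 0. Proof. by case: oQ => _ _; apply. Qed.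
Let LPl G : (size G <= m.+2)%N -> L (P * G) = G`_m.+1 * h.
Proof. by rewrite -Lh; exact: orthogonal_poly_lead. Qed.
Let LQl G : (size G <= m.+1)%N -> L (Q * G) = G`_m * g.
Proof. by rewrite -Lg; exact: orthogonal_poly_lead. Qed.

Let sX k f : (size f <= k)%N -> (size ('X * f)%R <= k.+1)%N.
Proof.
move=> sf; apply/leq_sizeP => -[//|i] ki.
by rewrite coefXM/= nth_default// (leq_trans sf).
Qed.

Let sXd k f : (size f <= k)%N -> (size ('X * f^`())%R <= k)%N.
Proof.
move=> sf; apply/leq_sizeP => i ki.
by rewrite coefXderiv nth_default ?mul0r// (leq_trans sf).
Qed.

Let LXPQ : L ('X * (P * Q)) = h.
Proof.
have -> : 'X * (P * Q) = P * ('X * Q) by ring.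
by rewrite LPl ?coefXM/= ?Q1 ?mul1r// sX// sQ.
Qed.

(* By the three-term recurrence, [T] is a multiple of the polynomial of degree
   [m.-1] (zero if [m = 0]); only its degree matters. *)
Let T := P - ('X - b%:P) * Q.

(** The leading terms cancel because both are monic; the pairing with [Q], zero by the choice of
    [b], then kills coefficient m. *)
Let sT : (size T <= m)%N.
Proof.
have sT1 : (size T <= m.+1)%N.
  apply/leq_sizeP => i; rewrite /T mulrBl coefB coefB coefXM coefCM leq_eqVlt.
  case: i => // i /predU1P[[<-]|mi] /=.
    by rewrite P1 Q1 (@nth_default _ _ Q) ?sQ// mulr0 subr0 subrr.
  by rewrite (@nth_default _ _ P) ?sP// !(@nth_default _ _ Q) ?sQ ?mulr0 ?subrr ?subr0// ltnW.
have : L (Q * T) = 0.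
  have -> : Q * T = P * Q - 'X * (Q * Q) + b%:P * (Q * Q) by rewrite /T; ring.
  by rewrite LD LB LC LP ?sQ// Lg LXQQ; ring.
rewrite LQl// => /eqP; rewrite mulf_eq0 (negPf g0) orbF => /eqP Tm.
apply/leq_sizeP => i; rewrite leq_eqVlt => /predU1P[<-//|mi].
by rewrite nth_default// (leq_trans sT1).
Qed.

Let PE : P = ('X - b%:P) * Q + T. Proof. by rewrite /T; ring. Qed.

(** Such an [f] is orthogonal to itself. Both ladder relations are proved this way: bound the degree
    of the difference of the two sides, then pair it with [Q] and with lower degrees. *)
Let vanish f : (size f <= m.+1)%N -> L (f * Q) = 0 ->
  (forall G, (size G <= m)%N -> L (f * G) = 0) -> f = 0.
Proof.
move=> sf fQ0 fG; case: Lok => _ _; apply.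
have -> : f * f = (f`_m)%:P * (f * Q) + f * (f - (f`_m)%:P * Q) by ring.
rewrite LD LC fQ0 mulr0 add0r fG//; apply: size_sub_lead => //; by case: oQ.
Qed.

(** Integration by parts: the Pearson identity for the product of [f] and [G], with the factor of
    [f] written so that its degree and coefficients can be read off. *)
Let pearsonM f G : L ('X * (1 - 'X) * f^`() * G) =
  - L (f * ('X * G^`() - 'X * ('X * G^`()))) - L (f * (q * G)).
Proof.
have := pearson (f * G); rewrite derivM.
have -> : 'X * (1 - 'X) * (f^`() * G + f * G^`()) + q * (f * G) =
  'X * (1 - 'X) * f^`() * G + f * ('X * G^`() - 'X * ('X * G^`())) + f * (q * G).
  by ring.
by rewrite !LD => /eqP; rewrite -addrA addr_eq0 opprD => /eqP.
Qed.

Let LPQ : L (P * Q) = 0. Proof. by rewrite LP// sQ. Qed.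

(** Replace one factor X Q by P + b Q - T; the term with [T] pairs to zero by degree. *)
Let LXXPQ : L ('X * ('X * (P * Q))) = (a + b) * h.
Proof.
have -> : 'X * ('X * (P * Q)) = 'X * (P * P) + b%:P * ('X * (P * Q)) - P * ('X * T).
  by rewrite /T; ring.
by rewrite LB LD LC LXPP LXPQ LP ?sX//; ring.
Qed.

Let LqPQ : L (P * (q * Q)) = (t - t * (a + b) - (2 + alpha + beta)) * h.
Proof.
have -> : P * (q * Q) = (1 + alpha)%:P * (P * Q) + (t - (2 + alpha + beta))%:P * ('X * (P * Q))
   - t%:P * ('X * ('X * (P * Q))) by rewrite /q; ring.
by rewrite LB LD !LC LPQ LXPQ LXXPQ; ring.
Qed.

Let coefXXderiv f k : ('X * ('X * f^`()))`_k = (k%:R - 1) * ('X * f)`_k.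
Proof.
case: k => [|k]; rewrite coefXM [in RHS]coefXM ?mulr0//=.
by rewrite coefXderiv; ring.
Qed.

Let sXXd k f : (size f <= k)%N -> (size ('X * f^`() - 'X * ('X * f^`()))%R <= k.+1)%N.
Proof.
move=> sf; apply: (leq_trans (size_polyD _ _)); rewrite size_polyN geq_max.
by rewrite leqW ?sXd// sX// sXd.
Qed.

(** The entries are forced: [n] and [s] cancel degrees m + 2 and m + 1, [fQ] makes the pairing with
    [Q] vanish, and t B the pairing with lower degrees. *)
Lemma ladder_up : 'X * (1 - 'X) * P^`() =
  ((t * B)%:P * 'X + fQ%:P) * Q - (n%:P * 'X + s%:P) * P.
Proof.
apply/eqP; rewrite -subr_eq0; apply/eqP; set f0 := fQ; set s0 := s.
apply: vanish.
- set E := _ - _.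
  have -> : E = 'X * P^`() - 'X * ('X * P^`()) - (t * B)%:P * ('X * Q) - f0%:P * Q
     + n%:P * ('X * P) + s0%:P * P by rewrite /E; ring.
  (* Abstracting X P' keeps [coefXM] from expanding it. *)
  set D := 'X * P^`(); have DE i : D`_i = P`_i * i%:R by exact: coefXderiv.
  move: D DE => D DE.
  apply/leq_sizeP => -[//|i]; rewrite ltnS leq_eqVlt.
  rewrite !(coefB, coefD, coefCM, coefXM)/= !DE => /predU1P[<-|].
    rewrite P1 Q1 (@nth_default _ _ Q) ?sQ// /s0; ring.
  rewrite leq_eqVlt => /predU1P[<-|mi].
    rewrite P1 !(@nth_default _ _ Q) ?sQ// (@nth_default _ _ P) ?sP//; ring.
  have [Q0 Q0'] : Q`_i = 0 /\ Q`_i.+1 = 0.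
    by split; rewrite nth_default// sQ ?leqW// ltnW.
  have [P0 P0'] : P`_i = 0 /\ P`_i.+1 = 0.
    by split; rewrite nth_default// sP// leqW.
  by rewrite Q0 Q0' P0 P0'; ring.
- set E := _ * _.
  have -> : E = 'X * (1 - 'X) * P^`() * Q - (t * B)%:P * ('X * (Q * Q)) - f0%:P * (Q * Q)
     + n%:P * ('X * (P * Q)) + s0%:P * (P * Q) by rewrite /E; ring.
  rewrite !(LB, LD, LC) pearsonM LPQ LXPQ LXQQ LqPQ Lg LPl ?sXXd ?sQ//.
  rewrite coefB coefXderiv coefXM/= coefXderiv (@nth_default _ _ Q) ?sQ// Q1 mul0r -BE /f0.
  ring.
- move=> G sG; set E := _ * _.
  have -> : E = 'X * (1 - 'X) * P^`() * G - (t * B)%:P * (Q * ('X * G)) - f0%:P * (Q * G)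
     + n%:P * (P * ('X * G)) + s0%:P * (P * G) by rewrite /E; ring.
  rewrite !(LB, LD, LC) pearsonM.
  have -> : P * (q * G) = (1 + alpha)%:P * (P * G) + (t - (2 + alpha + beta))%:P * (P * ('X * G))
     - t%:P * (P * ('X * ('X * G))) by rewrite /q; ring.
  rewrite !(LB, LD, LC) (LQ sG) (LP (leqW sG)) (LP (sX sG)) (LPl (sX (sX sG))) (LP (sXXd sG)).
  by rewrite (LQl (sX sG)) coefXM/= -BE; ring.
Qed.

(** The coefficient of [Q] is minus [q] up to a linear polynomial, so in the pairings with lower
    degrees the terms with [q] cancel after integration by parts. *)
Lemma ladder_down : 'X * (1 - 'X) * Q^`() =
  (cP%:P - t%:P * 'X) * P +
  (n%:P * 'X + s%:P - alpha%:P * (1 - 'X) + beta%:P * 'X - t%:P * ('X * (1 - 'X))) * Q.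
Proof.
apply/eqP; rewrite -subr_eq0; apply/eqP.
(* Coefficient m of X Q is the subleading coefficient of [Q], or 0 when m = 0. *)
have pE : p = ('X * Q)`_m - b.
  have : T`_m = 0 by rewrite nth_default.
  by rewrite /T mulrBl !coefB coefCM Q1 mulr1 => /eqP; rewrite subr_eq0 => /eqP.
have [U [sU PU]] : exists U : {poly F}, (size U <= m)%N /\ P = ('X - b%:P) * Q + U.
  by exists T.
set s0 := s; set c0 := cP; apply: vanish.
- set E := _ - _.
  (* With P = (X - b) Q + U the terms in X^2 Q cancel, and the value of [cP] leaves m X Q, which
     cancels the top term of X^2 Q'. *)
  have -> : E = 'X * Q^`() - 'X * ('X * Q^`()) + m%:R%:P * ('X * Q)
     - (s0 - alpha - c0 * b)%:P * Q - c0%:P * U + t%:P * ('X * U)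
     - (c0%:P - t%:P * 'X) * (P - (('X - b%:P) * Q + U)) by rewrite /E /c0; ring.
  rewrite -PU subrr mulr0 subr0.
  set D := 'X * Q^`(); have DE i : D`_i = Q`_i * i%:R by exact: coefXderiv.
  move: D DE => D DE.
  apply/leq_sizeP => -[//|i]; rewrite ltnS => mi.
  rewrite !(coefB, coefD, coefCM, coefXM)/= !DE.
  rewrite (@nth_default _ _ Q i.+1) ?sQ// !(@nth_default _ _ U) ?(leq_trans sU)// ?leqW//.
  move: mi; rewrite leq_eqVlt => /predU1P[<-|mi]; first by rewrite Q1; ring.
  by rewrite (@nth_default _ _ Q) ?sQ// !mul0r; ring.
- set E := (_ - _) * _.
  have -> : E = 'X * (1 - 'X) * Q^`() * Q - c0%:P * (P * Q) + t%:P * ('X * (P * Q))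
     - (n - 2)%:P * ('X * (Q * Q)) - (s0 + 1)%:P * (Q * Q) + Q * (q * Q) by rewrite /E /q; ring.
  set K := L ('X * (1 - 'X) * Q^`() * Q).
  (* Adding m X Q to X (1 - X) Q' cancels degree m + 1, so the pairing with [Q] reads off
     coefficient m. *)
  have KE : K = (m%:R + ('X * Q)`_m - m%:R * b) * g.
    have -> : K = L (Q * ('X * Q^`() - 'X * ('X * Q^`()) + m%:R%:P * ('X * Q))) - m%:R * L ('X * (Q * Q)).
      by rewrite -LC -LB /K; congr L; ring.
    rewrite LXQQ LQl.
      by rewrite coefD coefB coefXderiv coefXXderiv coefCM Q1; ring.
    apply/leq_sizeP => -[//|i]; rewrite ltnS => mi.
    rewrite !(coefB, coefD, coefCM) [('X * ('X * _))`_ _]coefXM !coefXderiv/= coefXM/=.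
    rewrite (@nth_default _ _ Q i.+1) ?sQ//.
    move: mi; rewrite leq_eqVlt => /predU1P[<-|mi]; first by rewrite Q1; ring.
    by rewrite (@nth_default _ _ Q) ?sQ// !mul0r; ring.
  have qE : L (Q * (q * Q)) = - K - K.
    have := pearsonM Q Q; rewrite -/K.
    have -> : Q * ('X * Q^`() - 'X * ('X * Q^`())) = 'X * (1 - 'X) * Q^`() * Q by ring.
    by rewrite -/K => KK; rewrite {2}KK; ring.
  rewrite !(LB, LD, LC) qE -/K LPQ LXPQ LXQQ Lg KE /s0 pE -BE; ring.
- move=> G sG; set E := (_ - _) * _.
  have -> : E = 'X * (1 - 'X) * Q^`() * G - c0%:P * (P * G) + t%:P * (P * ('X * G))
     - (n - 2)%:P * (Q * ('X * G)) - (s0 + 1)%:P * (Q * G) + Q * (q * G) by rewrite /E /q; ring.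
  rewrite !(LB, LD, LC) pearsonM (LQ sG) (LP (leqW sG)) (LP (sX sG)) (LQl (sX sG)) (LQl (sXXd sG)).
  rewrite coefB coefXderiv coefXXderiv (nth_default _ sG) mul0r /c0; ring.
Qed.

(** Dividing both by X - z gives P Q' = Q P'. The left side pairs to 0 by degree, whereas P' is
    monic of degree m, so the right side gives L(Q^2), which is nonzero. *)
Lemma no_common_root z : ~ (root P z /\ root Q z).
Proof.
move=> [/factor_theorem[P' PE'] /factor_theorem[Q' QE]].
have sQ' : (size Q' <= m.+1)%N.
  have Q'0 : Q' != 0.
    by apply: contra_eq_neq sQ => Q'0; rewrite QE Q'0 mul0r size_poly0.
  have := sQ; rewrite QE size_Mmonic ?monicXsubC// size_XsubC addn2/= => -[->].
  exact: leqnSn.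
have mP' : P' \is monic.
  by have [+ _ _] := oP; rewrite PE' monicMr ?monicXsubC.
have sP' : size P' = m.+1.
  have := sP; rewrite PE' size_Mmonic ?monicXsubC ?monic_neq0// size_XsubC addn2/=.
  by case.
have : L (P * Q') = 0 by rewrite LP.
have -> : P * Q' = Q * P' by rewrite PE' QE; ring.
rewrite LQl ?sP'//.
have -> : P'`_m = 1 by move: mP'; rewrite monicE /lead_coef sP' => /eqP.
by rewrite mul1r => /eqP; apply/negP.
Qed.

(** A homogeneous 2 x 2 system with the nonzero solution (P(z), Q(z)) has determinant zero. *)
Let det z (u v w x : F) :
  u * P.[z] = v * Q.[z] -> w * P.[z] = - (x * Q.[z]) -> u * x = - (v * w).
Proof.
move=> h1 h2; apply/eqP; rewrite -addr_eq0; apply: contraT => d0.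
case: (@no_common_root z); rewrite /root; split; apply/eqP; apply: (mulfI d0); rewrite mulr0.
  have -> : (u * x + v * w) * P.[z] = x * (u * P.[z]) + v * (w * P.[z]) by ring.
  by rewrite h1 h2; ring.
have -> : (u * x + v * w) * Q.[z] = u * (x * Q.[z]) + w * (v * Q.[z]) by ring.
by rewrite -h1 -[x * _]opprK -h2; ring.
Qed.

Let eqB (x y c d : F) : c = d -> x - y = d - c -> x = y.
Proof. by move=> -> /eqP; rewrite subrr subr_eq0 => /eqP. Qed.

Lemma ladder_det0 : s * (s - alpha) = - (fQ * cP).
Proof.
move: ladder_up ladder_down; set s0 := s; set f0 := fQ; set c0 := cP.
move=> /(congr1 (horner ^~ 0)) + /(congr1 (horner ^~ 0));
  rewrite -polyC1 !(hornerD, hornerN, hornerM, hornerX, hornerC) => h1 h2.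
by apply: (@det 0); [apply: (eqB (esym h1)); ring|apply: (eqB h2); ring].
Qed.

Lemma ladder_det1 : (n + s) * (n + beta + s) = - ((t * B + fQ) * (cP - t)).
Proof.
move: ladder_up ladder_down; set s0 := s; set f0 := fQ; set c0 := cP.
move=> /(congr1 (horner ^~ 1)) + /(congr1 (horner ^~ 1));
  rewrite -polyC1 !(hornerD, hornerN, hornerM, hornerX, hornerC) => h1 h2.
by apply: (@det 1); [apply: (eqB (esym h1)); ring|apply: (eqB h2); ring].
Qed.

End ladder.
(** * Dependence on the parameter *)

Section polynomial_curves.
Context {R : realType}.
Implicit Types (t c d : R) (f g : R -> R) (U V : R -> {poly R}) (D E : {poly R}).

Lemma is_derive_mulr f g t c d : is_derive t 1 f c -> is_derive t 1 g d ->
  is_derive t 1 (fun s => f s * g s) (c * g t + f t * d).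
Proof.
move=> df dg; apply: (is_derive_eq (is_deriveM df dg)).
by rewrite /GRing.scale/= addrC [_ * c]mulrC.
Qed.

Lemma is_derive_sumr k (f : 'I_k -> R -> R) (d : 'I_k -> R) t :
  (forall i, is_derive t 1 (f i) (d i)) ->
  is_derive t 1 (fun s => \sum_(i < k) f i s) (\sum_(i < k) d i).
Proof.
move=> df; have := is_derive_sum df.
by congr is_derive; apply/funext => s; rewrite fct_sumE.
Qed.

Lemma is_derive_divr f g t c d : g t != 0 ->
  is_derive t 1 f c -> is_derive t 1 g d ->
  is_derive t 1 (fun s => f s / g s) ((c - f t / g t * d) / g t).
Proof.
move=> g0 df dg.
apply: (is_derive_eq (is_derive_mulr df (is_deriveV g0 dg))).
by rewrite /GRing.scale/=; field.
Qed.

(* The size bound turns evaluation of a linear functional along the curve into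
   a finite sum of fixed length. *)
Definition poly_derive U t D :=
  (exists N, forall s, (size (U s) <= N)%N) /\
  forall i, is_derive t 1 (fun s => (U s)`_i) D`_i.

Lemma poly_derive_cst (p : {poly R}) t : poly_derive (fun=> p) t 0.
Proof.
split; first by exists (size p).
by move=> i; rewrite coef0; exact: is_derive_cst.
Qed.

Lemma poly_deriveC f t c : is_derive t 1 f c ->
  poly_derive (fun s => (f s)%:P) t c%:P.
Proof.
move=> df; split; first by exists 1%N => s; exact: size_polyC_leq1.
move=> i; rewrite coefC; under [fun s => _]eq_fun do rewrite coefC.
by case: eqP => // _; exact: is_derive_cst.
Qed.

Lemma poly_deriveB U V t D E : poly_derive U t D -> poly_derive V t E ->
  poly_derive (fun s => U s - V s) t (D - E).
Proof.
move=> [[N sU] dU] [[M sV] dV]; split.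
  exists (maxn N M) => s; apply: (leq_trans (size_polyD _ _)).
  by rewrite size_polyN geq_max !leq_max sU sV orbT.
move=> i; rewrite coefB; under [fun s => _]eq_fun do rewrite coefB.
exact: is_deriveB.
Qed.

Lemma poly_derive_sum k (U : 'I_k -> R -> {poly R}) t (D : 'I_k -> {poly R}) :
  (forall i, poly_derive (U i) t (D i)) ->
  poly_derive (fun s => \sum_(i < k) U i s) t (\sum_(i < k) D i).
Proof.
move=> dU; split.
  have /choice[N sN] : forall i, exists N, forall s, (size (U i s) <= N)%N.
    by move=> i; have [] := dU i.
  exists (\max_(i < k) N i) => s; apply: (leq_trans (size_sum _ _ _)).
  by apply/bigmax_leqP => i _; apply: (leq_trans (sN i s)); exact: leq_bigmax.
move=> i; rewrite coef_sum; under [fun s => _]eq_fun do rewrite coef_sum.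
by apply: is_derive_sumr => j; have [_] := dU j.
Qed.

Lemma poly_deriveM U V t D E : poly_derive U t D -> poly_derive V t E ->
  poly_derive (fun s => U s * V s) t (D * V t + U t * E).
Proof.
move=> [[N sU] dU] [[M sV] dV]; split.
  exists (N + M)%N => s; apply: (leq_trans (size_polyMleq _ _)).
  by apply: (leq_trans (leq_pred _)); exact: leq_add.
move=> i; rewrite coefD !coefM -big_split/=.
under [fun s => _]eq_fun do rewrite coefM.
by apply: is_derive_sumr => j; exact: is_derive_mulr.
Qed.

Lemma poly_derive_coef_cst U t D i (c : R) : poly_derive U t D ->
  (forall s, (U s)`_i = c) -> D`_i = 0.
Proof.
move=> [_ dU] Uc; have := dU i; under [fun s => _]eq_fun do rewrite Uc.
by move=> h; rewrite -(@derive_val _ _ _ _ _ _ _ h); exact: derive_cst.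
Qed.

Lemma poly_derive_size U t D N : poly_derive U t D ->
  (forall s, (size (U s) <= N)%N) -> (size D <= N)%N.
Proof.
move=> dU sU; apply/leq_sizeP => i Ni; apply: (poly_derive_coef_cst (c := 0) dU) => s.
by rewrite nth_default// (leq_trans (sU s)).
Qed.

(** The leading coefficient is constantly 1, so the derivative has lower degree; for orthogonal
    polynomials it thus pairs to zero with the polynomial itself. *)
Lemma poly_derive_monic_size U t D k : poly_derive U t D ->
  (forall s, U s \is monic /\ size (U s) = k.+1) -> (size D <= k)%N.
Proof.
move=> dU mU; apply/leq_sizeP => i; rewrite leq_eqVlt => /predU1P[<-|ki].
  apply: (poly_derive_coef_cst (c := 1) dU) => s.
  by have [/monicP + sUs] := mU s; rewrite /lead_coef sUs.
apply: (poly_derive_coef_cst (c := 0) dU) => s.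
by rewrite nth_default//; have [_ ->] := mU s.
Qed.

End polynomial_curves.

(** * Existence and differentiability of the orthogonal polynomials *)

Section jacobi_curves.
Context {R : realType} (alpha beta : R).
Hypotheses (halpha : -1 < alpha) (hbeta : -1 < beta).
Local Notation w t := (jacobi_exp_weight alpha beta (- t)).
Local Notation L := (jacobi_functional alpha beta).
Implicit Types (t : R) (U V : R -> {poly R}) (D E : {poly R}).

Lemma jacobi_functional_definite t : definite_functional (L t).
Proof.
split=> [f g|c f|f]; [exact: jacobi_functionalD|exact: jacobi_functionalC|].
exact: jacobi_functional_sqr_eq0.
Qed.

Let Lok := jacobi_functional_definite.

(** The moving weight contributes X U and the moving polynomial contributes [D], as an expansion in
    the moments L(X^i) up to a fixed degree shows. *)
Lemma is_derive_functional U t D : poly_derive U t D ->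
  is_derive t 1 (fun s => L s (U s)) (L t ('X * U t) + L t D).
Proof.
move=> dU; have [[N sU] dUi] := dU.
have sD := poly_derive_size dU sU.
have expand s (f g : {poly R}) : (size f <= N)%N ->
    L s (g * f) = \sum_(i < N) f`_i * L s (g * 'X^i).
  move=> sf; have fE : f = \poly_(i < N) f`_i.
    apply/polyP => i; rewrite coef_poly; case: ltnP => // Ni.
    by rewrite nth_default// (leq_trans sf).
  rewrite [in LHS]fE poly_def mulr_sumr (functional_sum (Lok s)); apply: eq_bigr => i _.
  rewrite -mul_polyC mulrCA.
  by have [_ -> _] := Lok s.
have -> : (fun s => L s (U s)) = fun s => \sum_(i < N) (U s)`_i * L s 'X^i.
  apply/funext => s; rewrite -[U s in LHS]mul1r (expand _ _ _ (sU s)).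
  by under eq_bigr do rewrite mul1r.
rewrite addrC -[D]mul1r (expand t _ _ sD) (expand t _ _ (sU t)) -big_split/=.
under eq_bigr do rewrite mul1r.
apply: is_derive_sumr => i; apply: is_derive_mulr.
exact: is_derive_jacobi_functional.
Qed.

(** Existence and differentiability share one induction: the Gram-Schmidt coefficients are quotients
    of functionals of the earlier curves. *)
Lemma orthogonal_curves n : exists S : nat -> R -> {poly R},
  forall k, (k < n)%N -> forall t,
    orthogonal_poly (L t) k (S k t) /\ exists D, poly_derive (S k) t D.
Proof.
elim: n => [|n [S hS]]; first by exists (fun _ _ => 0).
pose c k t := L t ('X^n * S k t) / L t (S k t * S k t).
pose T t := 'X^n - \sum_(k < n) (c k t)%:P * S k t.
exists (fun k => if k == n then T else S k) => k.
rewrite ltnS leq_eqVlt; case: eqP => [-> _ t|_ /= kn t]; last exact: hS.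
split.
  apply: (orthogonal_poly_gram_schmidt (Lok t) (S := S ^~ t)) => k' k'n.
  by have [] := hS _ k'n t.
have /choice[D hD] : forall k : 'I_n, exists D, poly_derive (fun s => (c k s)%:P * S k s) t D.
  move=> i; have [oi [D dS]] := hS i (ltn_ord i) t.
  eexists; apply: (poly_deriveM _ dS); apply: poly_deriveC; apply: is_derive_divr.
  - exact: orthogonal_poly_norm_neq0 oi.
  - apply: (@is_derive_functional (fun s => 'X^n * S i s)).
    exact: poly_deriveM (poly_derive_cst _ _) dS.
  - apply: (@is_derive_functional (fun s => S i s * S i s)).
    exact: (poly_deriveM dS dS).
by eexists; apply: poly_deriveB (poly_derive_cst _ _) (poly_derive_sum hD).
Qed.

Lemma orthopoly_orthogonal t k : orthogonal_poly (L t) k (orthopoly (w t) k).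
Proof.
have [mono orth] : monic_orthogonal_polys (w t) (orthopoly (w t)).
  (* The default of [xget] is excluded by exhibiting one sequence, built by Gram-Schmidt. *)
  apply: (@xgetPex _ _ [set P | monic_orthogonal_polys (w t) P]).
  have /choice[P hP] : forall k, exists P : {poly R}, orthogonal_poly (L t) k P.
    move=> j; have [S hS] := orthogonal_curves j.+1; exists (S j t).
    by have [] := hS j (ltnSn j) t.
  exists P; split=> [j|i j ij]; first by have [] := hP j.
  by apply/(orthogonal_on01E halpha hbeta)/(orthogonal_poly_mul_eq0 (hP i) (hP j)).
have [mk sk] := mono k; split => // G.
apply: (functional_mul_eq0 (Lok t)) => j jk; first exact: mono.
by apply/(orthogonal_on01E halpha hbeta)/orth => kj; rewrite kj ltnn in jk.
Qed.

(** The choice behind [orthopoly] is made separately at each parameter; uniqueness identifies it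
    with a differentiable Gram-Schmidt curve. *)
Lemma orthopoly_derive t k : exists D, poly_derive (fun s => orthopoly (w s) k) t D.
Proof.
have [S hS] := orthogonal_curves k.+1.
have -> : (fun s => orthopoly (w s) k) = S k.
  apply/funext => s; apply: (orthogonal_poly_unique (Lok s)).
    exact: orthopoly_orthogonal.
  by have [] := hS k (ltnSn k) s.
by have [] := hS k (ltnSn k) t.
Qed.

End jacobi_curves.

(** * Toda equations and the derivatives of sigma *)

Section toda.
Context {R : realType} (alpha beta : R).
Hypotheses (halpha : -1 < alpha) (hbeta : -1 < beta).
Local Notation L := (jacobi_functional alpha beta).
Local Notation OP k t := (orthopoly (jacobi_exp_weight alpha beta (- t)) k).
Local Notation nrm k t := (L t (OP k t * OP k t)).
Implicit Types (t : R) (k m : nat).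
Let Lok := jacobi_functional_definite halpha hbeta.
Let oOP := orthopoly_orthogonal halpha hbeta.

Lemma orthopoly_norm_neq0 k t : nrm k t != 0.
Proof. exact: (orthogonal_poly_norm_neq0 (Lok t) (oOP t k)). Qed.

Lemma orthopoly_derive_size k t D :
  poly_derive (fun s => OP k s) t D -> (size D <= k)%N.
Proof.
by move=> dD; apply: (poly_derive_monic_size dD) => s; have [] := oOP s k.
Qed.

Lemma is_derive_orthopoly_norm k t :
  is_derive t 1 (fun s => nrm k s) (L t ('X * (OP k t * OP k t))).
Proof.
have [D dD] := orthopoly_derive halpha hbeta t k.
have := is_derive_functional halpha hbeta (poly_deriveM dD dD).
have [LD _ _] := Lok t; have [_ _ o] := oOP t k.
by rewrite [D * _]mulrC LD o ?(orthopoly_derive_size dD)// !addr0.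
Qed.

(** In the derivative of L(P Q) = 0 the weight contributes L(X P Q) = L(P^2), the derivative of [P]
    its coefficient m times L(Q^2), and the derivative of [Q] nothing. *)
Lemma is_derive_subleading m t :
  is_derive t 1 (fun s => (OP m.+1 s)`_m) (- (nrm m.+1 t / nrm m t)).
Proof.
have [D dD] := orthopoly_derive halpha hbeta t m.+1.
have [E dE] := orthopoly_derive halpha hbeta t m.
have := is_derive_functional halpha hbeta (poly_deriveM dD dE).
have [LD _ _] := Lok t; have [mP sP oP] := oOP t m.+1; have [mQ sQ oQ] := oOP t m.
have -> : (fun s => L s (OP m.+1 s * OP m s)) = cst 0.
  by apply/funext => s; have [_ _ o] := oOP s m.+1; apply: o; have [_ -> _] := oOP s m.
move=> h; have := @derive_val _ _ _ _ _ _ _ h; rewrite derive_cst LD.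
have -> : D * OP m t = OP m t * D by rewrite mulrC.
rewrite (orthogonal_poly_lead (Lok t) (oOP t m) (orthopoly_derive_size dD)).
rewrite oP ?(leq_trans (orthopoly_derive_size dE))// addr0 mulrCA.
rewrite (orthogonal_poly_lead (Lok t) (oOP t m.+1)); last first.
  apply/leq_sizeP => -[//|i] mi; rewrite coefXM/= nth_default// sQ; exact: mi.
rewrite coefXM/= (orthogonal_poly_coef (oOP t m)) mul1r => /esym/eqP.
rewrite addrC addr_eq0 => /eqP DE.
have [_ /(_ m)] := dD; suff -> : D`_m = - (nrm m.+1 t / nrm m t) by [].
by apply: (mulIf (orthopoly_norm_neq0 m t)); rewrite DE mulNr divfK ?orthopoly_norm_neq0.
Qed.

(** The Toda equation: the logarithmic derivative of B is a - b. *)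
Lemma is_derive_orthopoly_norm_ratio m t :
  is_derive t 1 (fun s => nrm m.+1 s / nrm m s)
    (nrm m.+1 t / nrm m t *
     (L t ('X * (OP m.+1 t * OP m.+1 t)) / nrm m.+1 t
      - L t ('X * (OP m t * OP m t)) / nrm m t)).
Proof.
apply: (is_derive_eq (is_derive_divr (orthopoly_norm_neq0 m t)
  (is_derive_orthopoly_norm _ _) (is_derive_orthopoly_norm _ _))).
by field; rewrite !orthopoly_norm_neq0.
Qed.

Let pearson t f :
  L t ('X * (1 - 'X) * f^`() + pearson_poly alpha beta t * f) = 0.
Proof.
rewrite -[RHS](jacobi_functional_pearson halpha hbeta t f); congr L.
by rewrite /pearson_poly; ring.
Qed.

Lemma is_derive_sigma m t :
  is_derive t 1 (sigma_tilde alpha beta m.+1)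
    (t * (nrm m.+1 t / nrm m t) - m.+1%:R - (OP m.+1 t)`_m).
Proof.
have dp := is_derive_subleading m t.
have d1 : is_derive t 1 (fun s : R => m.+1%:R * s) m.+1%:R.
  by apply: is_derive_eq; rewrite /GRing.scale/=; ring.
have := is_deriveN (is_deriveB (is_deriveD d1 (is_derive_mulr (is_derive_id _ _) dp))
   (is_derive_cst (m.+1%:R * (m.+1%:R + beta) : R) t 1)).
move=> h; apply: (is_derive_eq h); ring.
Qed.

Lemma is_derive_sigma' m t :
  is_derive t 1 (fun t => t * (nrm m.+1 t / nrm m t) - m.+1%:R - (OP m.+1 t)`_m)
   (2 * (nrm m.+1 t / nrm m t) + t * (nrm m.+1 t / nrm m t *
     (L t ('X * (OP m.+1 t * OP m.+1 t)) / nrm m.+1 t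
      - L t ('X * (OP m t * OP m t)) / nrm m t))).
Proof.
have := is_deriveB (is_deriveB (is_derive_mulr (is_derive_id _ _) (is_derive_orthopoly_norm_ratio m t))
   (is_derive_cst (m.+1%:R : R) t 1)) (is_derive_subleading m t).
move=> h; apply: (is_derive_eq h); ring.
Qed.

(** [f] and [c] stay hidden behind the relations that the sigma-form needs; the last right-hand side
    is sigma''. *)
Lemma sigma_determinants m t (B a b s : R) :
  B = nrm m.+1 t / nrm m t ->
  a = L t ('X * (OP m.+1 t * OP m.+1 t)) / nrm m.+1 t ->
  b = L t ('X * (OP m t * OP m t)) / nrm m t ->
  s = t * B - m.+1%:R - (OP m.+1 t)`_m ->
  exists f c, [/\ s * (s - alpha) = - (f * c),
    (m.+1%:R + s) * (m.+1%:R + beta + s) = - ((t * B + f) * (c - t)) &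
    f + c * B = 2 * B + t * (B * (a - b))].
Proof.
move=> BE aE bE sE.
have h0 := orthopoly_norm_neq0 m.+1 t; have g0 := orthopoly_norm_neq0 m t.
have Bg : B * nrm m t = nrm m.+1 t by rewrite BE divfK.
have ah : L t ('X * (OP m.+1 t * OP m.+1 t)) = a * nrm m.+1 t by rewrite aE divfK.
have bg : L t ('X * (OP m t * OP m t)) = b * nrm m t by rewrite bE divfK.
exists (B * (2 * m.+1%:R + 1 + alpha + beta - t + t * a)).
exists (t - t * b - (2 * m.+1%:R - 1 + alpha + beta)); split; last by ring.
- rewrite sE.
  exact: (ladder_det0 (Lok t) (pearson t) (oOP t m.+1) (oOP t m) erefl erefl Bg ah bg).
- rewrite sE.
  exact: (ladder_det1 (Lok t) (pearson t) (oOP t m.+1) (oOP t m) erefl erefl Bg ah bg).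
Qed.

End toda.

(** * The sigma-form and its initial values *)

Theorem theorem3p2 (R : realType) (alpha beta : R) (n : nat)
    (halpha : -1 < alpha) (hbeta : -1 < beta) (hn : (1 <= n)%N) :
  let sigma := sigma_tilde alpha beta n in
  let sigma' := sigma^`() in
  let sigma'' := sigma^`(2) in
  twice_derivable sigma /\
  (forall lambda : R,
     (lambda * sigma'' lambda) ^+ 2 =
       (sigma lambda - lambda * sigma' lambda + 2 * sigma' lambda ^+ 2
        + (2 * n%:R - alpha + beta) * sigma' lambda) ^+ 2
       - 4 * sigma' lambda * (sigma' lambda - alpha)
           * (sigma' lambda + n%:R) * (sigma' lambda + n%:R + beta)) /\
  JimboMiwa_PV 0 (- alpha) n%:R (n%:R + beta) sigma /\
  sigma 0 = n%:R * (n%:R + beta) /\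
  sigma' 0 = - (n%:R * (n%:R + beta) / (2 * n%:R + alpha + beta)).
Proof.
case: n hn => // m _ sigma sigma' sigma''.
pose OP k t := orthopoly (jacobi_exp_weight alpha beta (- t)) k.
pose nrm k t := jacobi_functional alpha beta t (OP k t * OP k t).
pose c k t := jacobi_functional alpha beta t ('X * (OP k t * OP k t)) / nrm k t.
pose B t := nrm m.+1 t / nrm m t.
pose s1 t := t * B t - m.+1%:R - (OP m.+1 t)`_m.
pose s2 t := 2 * B t + t * (B t * (c m.+1 t - c m t)).
have d1 (t : R) : is_derive t 1 sigma (s1 t) by exact: is_derive_sigma.
have s1E : sigma' = s1.
  by apply/funext => t; rewrite /sigma' derive1E; have h := d1 t; rewrite derive_val.
have d2 (t : R) : is_derive t 1 s1 (s2 t) by exact: is_derive_sigma'.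
have s2E : sigma'' = s2.
  apply/funext => t; rewrite /sigma'' /derive1n/= -/sigma' s1E derive1E.
  by have h := d2 t; rewrite derive_val.
have sigmaE (t : R) : sigma t = m.+1%:R * (m.+1%:R + beta) - t * (m.+1%:R + (OP m.+1 t)`_m).
  by rewrite /sigma /sigma_tilde /subleading -/(OP m.+1 t)/=; ring.
have ode (t : R) : (t * sigma'' t) ^+ 2 =
       (sigma t - t * sigma' t + 2 * sigma' t ^+ 2
        + (2 * m.+1%:R - alpha + beta) * sigma' t) ^+ 2
       - 4 * sigma' t * (sigma' t - alpha)
           * (sigma' t + m.+1%:R) * (sigma' t + m.+1%:R + beta).
  rewrite s1E s2E sigmaE.
  have [f [k [E0 E1 E2]]] := @sigma_determinants R alpha beta halpha hbeta m t
    _ _ _ _ erefl erefl erefl erefl.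
  rewrite -/(nrm m.+1 t) -/(nrm m t) -/(B t) -/(s1 t) -/(c m.+1 t) -/(c m t) -/(s2 t) in E0 E1 E2.
  (* Eliminate p in favour of sigma'. Below, [s] is sigma', [b] is B, and [k] is the constant term
     called c above. *)
  have -> : (OP m.+1 t)`_m = t * B t - m.+1%:R - s1 t by rewrite /s1; ring.
  rewrite -E2; move: (s1 t) (B t) E0 E1 => s b E0 E1 {E2}.
  have -> : m.+1%:R * (m.+1%:R + beta) - t * (m.+1%:R + (t * b - m.+1%:R - s)) - t * s
      + 2 * s ^+ 2 + (2 * m.+1%:R - alpha + beta) * s = - (f * (k - t) + k * (t * b + f)).
    (* The bracket is the sum of the left sides of the two determinant relations, minus t^2 B. *)
    transitivity (s * (s - alpha) + (m.+1%:R + s) * (m.+1%:R + beta + s) - t * t * b).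
      by ring.
    by rewrite E0 E1; ring.
  have -> : 4 * s * (s - alpha) * (s + m.+1%:R) * (s + m.+1%:R + beta) =
      4 * ((s * (s - alpha)) * ((m.+1%:R + s) * (m.+1%:R + beta + s))) by ring.
  by rewrite E0 E1; ring.
split; [|split; [|split; [|split]]] => //.
- move=> t; split; first by have h := d1 t; exact: ex_derive.
  rewrite -/sigma' s1E; have h := d2 t; exact: ex_derive.
- move=> t; rewrite -/sigma' -/sigma'' ode; ring.
- by rewrite sigmaE mul0r subr0.
(* At t = 0 both determinants have the same right side. Subtracting them removes s^2 and leaves a
   linear equation, whose coefficient 2 n + alpha + beta is positive since n is at least 1. *)
- have [f [k [E0 E1 _]]] := @sigma_determinants R alpha beta halpha hbeta m 0
    _ _ _ _ erefl erefl erefl erefl.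
  rewrite s1E; move: E0 E1; rewrite -/(nrm m.+1 0) -/(nrm m 0) -/(B 0) -/(s1 0).
  move: (s1 0) => s E0; rewrite mul0r add0r subr0 -E0 => E1.
  have pos : 0 < 2 * m.+1%:R + alpha + beta.
    have : (1 : R) <= m.+1%:R by rewrite ler1n.
    by move: (m.+1%:R : R) => N N1; lra.
  apply: (mulIf (lt0r_neq0 pos)); rewrite mulNr divfK ?lt0r_neq0//.
  have -> : s * (2 * m.+1%:R + alpha + beta) =
     (m.+1%:R + s) * (m.+1%:R + beta + s) - s * (s - alpha) - m.+1%:R * (m.+1%:R + beta) by ring.
  by rewrite E1; ring.
Qed.
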